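(* Every left invariant pseudo-Riemannian metric (of arbitrary signature) on the three-dimensional sphere $S^3$, viewed as a Lie group, is invariantly rigid. That is, if $g$ and $\bar g$ are left invariant pseudo-Riemannian metrics on $S^3$ that are affinely equivalent, then $\bar g=\lambda g$ for some constant $\lambda\neq 0$.
   Context: The sphere $S^3$ is regarded as a Lie group, namely the multiplicative group of unit quaternions, whose Lie algebra is isomorphic to $so(3)$. Metrics are Riemannian or pseudo-Riemannian of arbitrary signature. Two metrics are affinely equivalent if their Levi-Civita connections coincide. A Lie group $G$ with a left invariant metric is regarded as a homogeneous space $G/\{e\}$; accordingly, a left invariant metric $g$ on $G$ is called invariantly rigid if the only left invariant metrics on $G$ affinely equivalent to $g$ are the metrics $\lambda g$ with a constant $\lambda\neq 0$. *)

(* Defs.v *)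
From HB Require Import structures.
From mathcomp Require Import all_boot all_order all_algebra.
From mathcomp Require Import ring.
From mathcomp Require Import all_classical all_reals all_analysis.

Set Implicit Arguments.
Unset Strict Implicit.
Unset Printing Implicit Defensive.

Import Order.TTheory GRing.Theory Num.Theory.
Import numFieldNormedType.Exports.

Local Open Scope classical_set_scope.
Local Open Scope ring_scope.

(* The row (a, b, c, d) stands for the quaternion a + b i + c j + d k. *)

Section Quaternions.
Variable R : realType.
Implicit Types x y z : 'rV[R]_4.

Definition mkq (a b c d : R) : 'rV[R]_4 := \row_(i < 4) [:: a; b; c; d]`_i.

Definition qdot x y : R := \sum_(i < 4) x 0 i * y 0 i.

Definition qone : 'rV[R]_4 := mkq 1 0 0 0.

Definition qconj x : 'rV[R]_4 :=
  mkq (x 0 0) (- x 0 1) (- x 0 2) (- x 0 3).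

Definition qmul x y : 'rV[R]_4 :=
  mkq (x 0 0 * y 0 0 - x 0 1 * y 0 1 - x 0 2 * y 0 2 - x 0 3 * y 0 3)
      (x 0 0 * y 0 1 + x 0 1 * y 0 0 + x 0 2 * y 0 3 - x 0 3 * y 0 2)
      (x 0 0 * y 0 2 - x 0 1 * y 0 3 + x 0 2 * y 0 0 + x 0 3 * y 0 1)
      (x 0 0 * y 0 3 + x 0 1 * y 0 2 - x 0 2 * y 0 1 + x 0 3 * y 0 0).

Lemma mkqE a b c d : (mkq a b c d 0 0 = a) * (mkq a b c d 0 1 = b) *
  (mkq a b c d 0 2 = c) * (mkq a b c d 0 3 = d).
Proof. by rewrite !mxE. Qed.

Lemma quatP x y : x 0 0 = y 0 0 -> x 0 1 = y 0 1 -> x 0 2 = y 0 2 ->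
  x 0 3 = y 0 3 -> x = y.
Proof.
move=> e0 e1 e2 e3; apply/rowP => -[[|[|[|[|//]]]] lti].
- by rewrite (_ : Ordinal lti = 0)//; apply/val_inj.
- by rewrite (_ : Ordinal lti = 1)//; apply/val_inj.
- by rewrite (_ : Ordinal lti = 2)//; apply/val_inj.
- by rewrite (_ : Ordinal lti = 3)//; apply/val_inj.
Qed.

Lemma qdotE x y : qdot x y =
  x 0 0 * y 0 0 + x 0 1 * y 0 1 + x 0 2 * y 0 2 + x 0 3 * y 0 3.
Proof.
rewrite /qdot !big_ord_recl big_ord0 addr0 !addrA.
by congr (_ * _ + _ * _ + _ * _ + _ * _); congr (_ 0 _); apply/val_inj.
Qed.

Lemma qmulA : associative qmul.
Proof. by move=> x y z; apply: quatP; rewrite !mkqE; ring. Qed.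

Lemma qmul1q : left_id qone qmul.
Proof. by move=> x; apply: quatP; rewrite !mkqE; ring. Qed.

Lemma qmulq1 : right_id qone qmul.
Proof. by move=> x; apply: quatP; rewrite !mkqE; ring. Qed.

Lemma qdot_mul x y : qdot (qmul x y) (qmul x y) = qdot x x * qdot y y.
Proof. by rewrite !qdotE !mkqE; ring. Qed.

Lemma qdot_one : qdot qone qone = 1.
Proof. by rewrite qdotE !mkqE; ring. Qed.

Lemma qdot_conj x : qdot (qconj x) (qconj x) = qdot x x.
Proof. by rewrite !qdotE !mkqE; ring. Qed.

Lemma qmulVq x : qdot x x = 1 -> qmul (qconj x) x = qone.
Proof.
rewrite qdotE => x1.
by apply: quatP; rewrite !mkqE; [rewrite -x1|..]; ring.
Qed.

Lemma qmulqV x : qdot x x = 1 -> qmul x (qconj x) = qone.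
Proof.
rewrite qdotE => x1.
by apply: quatP; rewrite !mkqE; [rewrite -x1|..]; ring.
Qed.

End Quaternions.

Record S3 (R : realType) := MkS3 {
  qval :> 'rV[R]_4 ;
  qvalP : qdot qval qval == 1 }.

HB.instance Definition _ (R : realType) := [isSub for @qval R].
HB.instance Definition _ (R : realType) := [Choice of S3 R by <:].

Section S3Group.
Variable R : realType.
Implicit Types p q : S3 R.

Fact S3_one_subproof : qdot (qone R) (qone R) == 1.
Proof. by rewrite qdot_one. Qed.

Fact S3_mul_subproof p q : qdot (qmul p q) (qmul p q) == 1.
Proof. by rewrite qdot_mul !(eqP (qvalP _)) mulr1. Qed.

Fact S3_inv_subproof p : qdot (qconj p) (qconj p) == 1.
Proof. by rewrite qdot_conj qvalP. Qed.

Definition S3_one : S3 R := MkS3 S3_one_subproof.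
Definition S3_mul p q : S3 R := MkS3 (S3_mul_subproof p q).
Definition S3_inv p : S3 R := MkS3 (S3_inv_subproof p).

Fact S3_mulA : associative S3_mul.
Proof. by move=> p q r; apply/val_inj/qmulA. Qed.

Fact S3_mul1 : left_id S3_one S3_mul.
Proof. by move=> p; apply/val_inj/qmul1q. Qed.

Fact S3_mulr1 : right_id S3_one S3_mul.
Proof. by move=> p; apply/val_inj/qmulq1. Qed.

Fact S3_mulV : left_inverse S3_one S3_inv S3_mul.
Proof. by move=> p; apply/val_inj/qmulVq/eqP/qvalP. Qed.

Fact S3_mulrV : right_inverse S3_one S3_inv S3_mul.
Proof. by move=> p; apply/val_inj/qmulqV/eqP/qvalP. Qed.

HB.instance Definition _ := isGroup.Build (S3 R)
  S3_mulA S3_mul1 S3_mulr1 S3_mulV S3_mulrV.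

End S3Group.

Section Calculus.
Variable R : realType.

(* F is of class C^n on the (open) set U. *)
Fixpoint Cn (n : nat) (V W : normedModType R) (U : set V) (F : V -> W) : Prop :=
  if n is m.+1 then
    (forall x, U x -> differentiable F x) /\ forall v, Cn m U ('D_v F)
  else forall x, U x -> {for x, continuous F}.

Definition smooth (W : normedModType R) (f : S3 R -> W) : Prop :=
  forall p : S3 R, exists (U : set 'rV[R]_4) (F : 'rV[R]_4 -> W),
    [/\ open U, U p, (forall n, Cn n U F) & forall q : S3 R, U q -> F q = f q].

(* x |-> x / |x|, with an arbitrary value at 0 *)
Definition retract (x : 'rV[R]_4) : S3 R :=
  insubd (S3_one R) ((Num.sqrt (qdot x x))^-1 *: x).

Definition tangent (p : S3 R) (v : 'rV[R]_4) : Prop := qdot p v = 0.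

(* The differential at p of f, applied to the tangent vector v: near p, the
   function f \o retract is a smooth extension of f to the ambient space. *)
Definition dS (W : normedModType R) (f : S3 R -> W) (p : S3 R) (v : 'rV[R]_4)
  : W := 'D_v (f \o retract) (qval p).

Definition vector_field (X : S3 R -> 'rV[R]_4) : Prop :=
  smooth X /\ forall p, tangent p (X p).

Definition lieD (X : S3 R -> 'rV[R]_4) (f : S3 R -> R^o) : S3 R -> R^o :=
  fun p => dS f p (X p).

(* Z = [X, Y] *)
Definition is_bracket (X Y Z : S3 R -> 'rV[R]_4) : Prop :=
  forall f : S3 R -> R^o, smooth f ->
    lieD Z f =1 lieD X (lieD Y f) \- lieD Y (lieD X f).

End Calculus.

Section Metrics.
Variable R : realType.

(* A (0,2)-tensor; only its values on pairs of tangent vectors at the base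
   point are meaningful. *)
Definition tensor02 := S3 R -> 'rV[R]_4 -> 'rV[R]_4 -> R^o.

Definition pseudo_riemannian (g : tensor02) : Prop :=
  [/\ forall p (a : R) u v w, tangent p u -> tangent p v -> tangent p w ->
        g p (a *: u + v) w = a * g p u w + g p v w,
      forall p u v, tangent p u -> tangent p v -> g p u v = g p v u,
      forall p u, tangent p u ->
        (forall v, tangent p v -> g p u v = 0) -> u = 0
    & forall X Y, vector_field X -> vector_field Y ->
        smooth (fun p => g p (X p) (Y p))].

Definition left_translation (a p : S3 R) : S3 R := (a * p)%g.

Definition left_invariant (g : tensor02) : Prop :=
  forall (a p : S3 R) u v, tangent p u -> tangent p v ->
    g (left_translation a p)
      (dS (@qval R \o left_translation a) p u)
      (dS (@qval R \o left_translation a) p v) = g p u v.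

(* Only the values on smooth vector fields are meaningful. *)
Definition connection := (S3 R -> 'rV[R]_4) -> (S3 R -> 'rV[R]_4) ->
  S3 R -> 'rV[R]_4.

Definition is_connection (nabla : connection) : Prop :=
  [/\ forall X Y, vector_field X -> vector_field Y ->
        vector_field (nabla X Y),
      forall X1 X2 Y, vector_field X1 -> vector_field X2 -> vector_field Y ->
        nabla (X1 \+ X2) Y =1 nabla X1 Y \+ nabla X2 Y,
      forall (f : S3 R -> R^o) X Y, smooth f -> vector_field X ->
        vector_field Y ->
        forall p, nabla (fun q => f q *: X q) Y p = f p *: nabla X Y p,
      forall X Y1 Y2, vector_field X -> vector_field Y1 -> vector_field Y2 ->
        nabla X (Y1 \+ Y2) =1 nabla X Y1 \+ nabla X Y2
    & forall (f : S3 R -> R^o) X Y, smooth f -> vector_field X ->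
        vector_field Y ->
        forall p, nabla X (fun q => f q *: Y q) p =
                  lieD X f p *: Y p + f p *: nabla X Y p].

Definition torsion_free (nabla : connection) : Prop :=
  forall X Y, vector_field X -> vector_field Y ->
    is_bracket X Y (nabla X Y \- nabla Y X).

Definition metric_compatible (g : tensor02) (nabla : connection) : Prop :=
  forall X Y Z, vector_field X -> vector_field Y -> vector_field Z ->
    forall p, lieD Z (fun q => g q (X q) (Y q)) p =
              g p (nabla Z X p) (Y p) + g p (X p) (nabla Z Y p).

Definition levi_civita (g : tensor02) (nabla : connection) : Prop :=
  [/\ is_connection nabla, torsion_free nabla & metric_compatible g nabla].

(* The Levi-Civita connection of a metric exists and is unique on vector
   fields, so this says that the two Levi-Civita connections coincide. *)
Definition affinely_equivalent (g gbar : tensor02) : Prop :=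
  exists nabla, levi_civita g nabla /\ levi_civita gbar nabla.

Definition invariantly_rigid (g : tensor02) : Prop :=
  forall gbar : tensor02, pseudo_riemannian gbar -> left_invariant gbar ->
    affinely_equivalent g gbar ->
    exists2 lambda : R, lambda != 0 &
      forall p u v, tangent p u -> tangent p v ->
        gbar p u v = lambda * g p u v.

End Metrics.

(* Main.v *)
From HB Require Import structures.
Require Import Defs.
From mathcomp Require Import all_boot all_order all_algebra.
From mathcomp Require Import ring lra.
From mathcomp Require Import all_classical all_reals all_analysis.

(** Left invariant vector fields reduce the theorem to linear algebra on the
    imaginary quaternions, identified with R^3, where the Lie bracket is twice
    the cross product.

    The scalar product of two left invariant fields is constant. Hence, if M_v
    denotes the covariant derivative of left invariant fields in the direction
    v, evaluated at the unit, then M_v is skew for the Gram matrix G of g and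
    also for the Gram matrix H of the other metric. Skew matrices of size 3 are
    cross products, so M_v G = [t_v] and M_v H = [s_v] for axial vectors t_v
    and s_v that depend linearly on v. The vanishing of the torsion determines
    them: t_v = v K(G) and s_v = v K(H), where K(G) = 2 G - (tr G) I
    ([levi_civita_koszul]).

    Now t_v M_v G is the cross product of t_v with itself, so t_v M_v = 0 and
    thus t_v M_v H = 0, which says that s_v is collinear to t_v, for every v.
    Since G is invertible, K(G) has rank at least 2 ([koszul_rank_gt1]), and
    pointwise collinearity then forces K(H) = c K(G)
    ([collinear_proportional]), whence H = c G ([common_levi_civita]). Finally,
    by left invariance, proportionality at the unit gives proportionality
    everywhere, with the same factor.

    On the analytic side, only linear functions have to be differentiated: left
    invariant fields and left translations are restrictions of linear maps of
    R^4, whose differential on the sphere is the map itself ([dS_linear]). *)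

Set Implicit Arguments.
Unset Strict Implicit.
Unset Printing Implicit Defensive.

Import Order.TTheory GRing.Theory Num.Theory.
Import numFieldNormedType.Exports.

Local Open Scope classical_set_scope.
Local Open Scope ring_scope.

(** * The cross product and metrics on R^3 *)

Lemma ord3_ind (P : 'I_3 -> Prop) : P 0 -> P 1 -> P 2 -> forall i, P i.
Proof.
move=> P0 P1 P2 [[|[|[|//]]] lti].
- by rewrite (_ : Ordinal lti = 0) //; apply/val_inj.
- by rewrite (_ : Ordinal lti = 1) //; apply/val_inj.
- by rewrite (_ : Ordinal lti = 2) //; apply/val_inj.
Qed.

Lemma sum3E (V : nmodType) (F : 'I_3 -> V) : \sum_i F i = F 0 + F 1 + F 2.
Proof.
rewrite !big_ord_recl big_ord0 addr0 addrA.
by congr (F _ + F _ + F _); apply/val_inj.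
Qed.

Section CrossProduct.
Variable R : realFieldType.
Implicit Types (a b z : 'rV[R]_3) (A G H : 'M[R]_3).

Definition vec3 (r s t : R) : 'rV[R]_3 := \row_(i < 3) [:: r; s; t]`_i.

Definition cross a b : 'rV[R]_3 :=
  vec3 (a 0 1 * b 0 2 - a 0 2 * b 0 1)
       (a 0 2 * b 0 0 - a 0 0 * b 0 2)
       (a 0 0 * b 0 1 - a 0 1 * b 0 0).

(** These are all the skew matrices of size 3 ([skew_crossmx]); b is called the
    axial vector of [crossmx b]. *)
Definition crossmx b : 'M[R]_3 := \matrix_i cross (delta_mx 0 i) b.

Lemma vec3E r s t :
  (vec3 r s t 0 0 = r) * (vec3 r s t 0 1 = s) * (vec3 r s t 0 2 = t).
Proof. by rewrite !mxE. Qed.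

Lemma rV3P a b : a 0 0 = b 0 0 -> a 0 1 = b 0 1 -> a 0 2 = b 0 2 -> a = b.
Proof. by move=> e0 e1 e2; apply/rowP; apply: ord3_ind. Qed.

Lemma crossE a b :
  (cross a b 0 0 = a 0 1 * b 0 2 - a 0 2 * b 0 1) *
  (cross a b 0 1 = a 0 2 * b 0 0 - a 0 0 * b 0 2) *
  (cross a b 0 2 = a 0 0 * b 0 1 - a 0 1 * b 0 0).
Proof. by rewrite !vec3E. Qed.

Lemma crossDl b z a : cross (a + b) z = cross a z + cross b z.
Proof. by apply: rV3P; rewrite [RHS]mxE !crossE !mxE; ring. Qed.

Lemma crossDr b z a : cross z (a + b) = cross z a + cross z b.
Proof. by apply: rV3P; rewrite [RHS]mxE !crossE !mxE; ring. Qed.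

Lemma crossZl k a b : cross (k *: a) b = k *: cross a b.
Proof. by apply: rV3P; rewrite [RHS]mxE !crossE !mxE; ring. Qed.

Lemma crossZr k a b : cross a (k *: b) = k *: cross a b.
Proof. by apply: rV3P; rewrite [RHS]mxE !crossE !mxE; ring. Qed.

Lemma cross0l b : cross 0 b = 0.
Proof. by apply: rV3P; rewrite !crossE !mxE; ring. Qed.

Lemma cross0r a : cross a 0 = 0.
Proof. by apply: rV3P; rewrite !crossE !mxE; ring. Qed.

Lemma crossC a b : cross a b = - cross b a.
Proof. by apply: rV3P; rewrite [RHS]mxE !crossE; ring. Qed.

Lemma crossxx a : cross a a = 0.
Proof. by apply: rV3P; rewrite !crossE mxE; ring. Qed.

Lemma mul_crossmx a b : a *m crossmx b = cross a b.
Proof.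
by apply: rV3P; rewrite mxE sum3E ![crossmx _ _ _]mxE !crossE !mxE /=; ring.
Qed.

Lemma skew_crossmx A : A^T = - A -> exists b, A = crossmx b.
Proof.
move=> skewA; have sk i j : A j i = - A i j.
  by move/matrixP/(_ i j): skewA; rewrite !mxE.
exists (vec3 (A 2 1) (A 0 2) (A 1 0)).
have d0 i : A i i = 0 by have := sk i i; lra.
apply/row_matrixP; apply: ord3_ind; rewrite rowE [RHS]rowE mul_crossmx;
  apply: rV3P; rewrite -rowE !crossE !vec3E !mxE /= ?d0 /=;
  rewrite ?(sk 1 0) ?(sk 2 0) ?(sk 2 1); ring.
Qed.

Lemma cross0_minor a b i j : cross a b = 0 -> a 0 i * b 0 j = a 0 j * b 0 i.
Proof.
move=> /rowP ab0; have := (ab0 0, ab0 1, ab0 2); rewrite !crossE !mxE.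
by move=> [[e0 e1] e2]; elim/ord3_ind: i; elim/ord3_ind: j; lra.
Qed.

Lemma cross0_collinear a b : b != 0 -> cross a b = 0 -> exists k, a = k *: b.
Proof.
move=> /rV0Pn[i bi0] ab0; exists (a 0 i / b 0 i); apply/rowP => j.
by rewrite !mxE mulrAC (cross0_minor _ _ ab0) mulfK.
Qed.

Lemma cross2_eq0 z a b : cross a b != 0 -> cross z a = 0 -> cross z b = 0 ->
  z = 0.
Proof.
move=> ab0 za0 zb0; apply/eqP/negPn/negP => z0; case/negP: ab0; apply/eqP.
have [|k ->] := cross0_collinear z0 (a := a); first by rewrite crossC za0 oppr0.
by rewrite crossZl zb0 scaler0.
Qed.

(** Two linear maps which send every vector to collinear vectors differ by a
    scalar as soon as the second one has rank at least 2: the factor is the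
    same on two vectors v, w with independent images, because v + w must be
    scaled too, and what is left of T after subtracting that multiple of U is
    then collinear to both images. *)
Lemma collinear_proportional (T U : 'M[R]_3) v w :
  (forall x : 'rV_3, cross (x *m T) (x *m U) = 0) ->
  cross (v *m U) (w *m U) != 0 -> exists c, T = c *: U.
Proof.
set a := v *m U; set b := w *m U => TU ab0.
(* polarization of the collinearity hypothesis *)
have pol x y : cross (x *m T) (y *m U) + cross (y *m T) (x *m U) = 0.
  have := TU (x + y); rewrite !mulmxDl !crossDl !crossDr !TU.
  by rewrite add0r addr0.
have a0 : a != 0.
  by apply: contra_neq ab0 => ->; exact: cross0l.
have b0 : b != 0.
  by apply: contra_neq ab0 => ->; exact: cross0r.
have [k Tv] := cross0_collinear a0 (TU v).
have [l Tw] := cross0_collinear b0 (TU w).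
have crossTa x : cross (x *m T) a = k *: cross (x *m U) a.
  have := pol x v; rewrite Tv -/a crossZl [cross a _]crossC scalerN => /eqP.
  by rewrite subr_eq0 => /eqP.
have kl : l = k.
  move: (crossTa w); rewrite Tw crossZl => /eqP.
  rewrite -subr_eq0 -scalerBl scaler_eq0 [cross _ a]crossC oppr_eq0 -/b.
  by rewrite (negPf ab0) orbF subr_eq0 => /eqP.
have crossTb x : cross (x *m T) b = k *: cross (x *m U) b.
  have := pol x w; rewrite Tw -/b kl crossZl [cross b _]crossC scalerN => /eqP.
  by rewrite subr_eq0 => /eqP.
exists k; apply/row_matrixP => i; rewrite !rowE.
apply/eqP; rewrite -subr_eq0 -mulmxBr; apply/eqP; apply: (cross2_eq0 ab0).
  by rewrite mulmxBr -scalemxAr crossDl -scaleNr crossZl crossTa scaleNr subrr.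
by rewrite mulmxBr -scalemxAr crossDl -scaleNr crossZl crossTb scaleNr subrr.
Qed.

(** The Koszul formula for a left invariant metric G on the unit quaternions:
    once an index is lowered by G, the covariant derivative of left invariant
    fields in the direction v is the cross product with v *m koszul G. *)
Definition koszul G : 'M[R]_3 := 2 *: G - (\tr G)%:M.

Lemma tr_koszul G : \tr (koszul G) = - \tr G.
Proof.
by rewrite /koszul raddfB /= mxtraceZ mxtrace_scalar -mulr_natl; ring.
Qed.

(** The trace of koszul G is that of - G, so G can be read off from koszul G
    by a linear formula. *)
Lemma koszul_inj_scale c G H : koszul H = c *: koszul G -> H = c *: G.
Proof.
move=> HG; have trHG : \tr H = c * \tr G.
  by apply: oppr_inj; rewrite -tr_koszul HG mxtraceZ tr_koszul mulrN.
move: HG; rewrite /koszul trHG scalerBr scale_scalar_mx => /addIr.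
rewrite scalerA mulrC -scalerA => /scalerI; apply; by rewrite pnatr_eq0.
Qed.

(** A matrix U whose rows are pairwise collinear is a product of a column by a
    row, hence U *m U = \tr U *: U. *)
Lemma collinear_rows_sqr (U : 'M[R]_3) :
  (forall i j, cross (row i U) (row j U) = 0) -> U *m U = \tr U *: U.
Proof.
move=> U1; apply/matrixP => i k; rewrite !mxE mulrC mulr_sumr.
by apply: eq_bigr => j _; have := cross0_minor j k (U1 i j); rewrite !mxE.
Qed.

(** Otherwise U = koszul G would satisfy U *m U = \tr U *: U, that is
    U *m (U + (\tr G)%:M) = 2 *: (U *m G) = 0, whence U = 0 and then G = 0. *)
Lemma koszul_rank_gt1 G : G \in unitmx ->
  exists i j, cross (row i (koszul G)) (row j (koszul G)) != 0.
Proof.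
move=> uG; set U := koszul G; have [|noij] :=
  boolP [exists i, [exists j, cross (row i U) (row j U) != 0]].
  by move=> /existsP[i /existsP[j]]; exists i, j.
have UU : U *m U = \tr U *: U.
  apply: collinear_rows_sqr => i j.
  by apply/eqP/negPn/(existsPn (existsPn noij i)).
have : U *m (2 *: G) = 0.
  have -> : 2 *: G = U + (\tr G)%:M by rewrite subrK.
  by rewrite mulmxDr UU tr_koszul scaleNr mul_mx_scalar addNr.
rewrite -scalemxAr => /eqP; rewrite scaler_eq0 pnatr_eq0 /= => /eqP UG0.
have U0 : U = 0 by rewrite -(mulmxK uG U) UG0 mul0mx.
have /eqP : G = 0 *: G by apply: koszul_inj_scale; rewrite scale0r.
rewrite scale0r => /eqP G0; move: uG.
by rewrite G0 unitmxE det0 // unitr0.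
Qed.

(** The nine entries of the torsion equations for (i, j) = (0, 1), (1, 2),
    (2, 0) form a regular linear system for the nine entries of U. *)
Lemma torsion_koszul G (U : 'M[R]_3) : G^T = G ->
  (forall i j, cross (delta_mx 0 j) (row i U) - cross (delta_mx 0 i) (row j U)
     = 2 *: cross (delta_mx 0 i) (delta_mx 0 j) *m G) ->
  U = koszul G.
Proof.
move=> symG tors; have sG i j : G j i = G i j by rewrite -{1}symG mxE.
have E i j k :
    cross (delta_mx 0 j) (row i U) 0 k - cross (delta_mx 0 i) (row j U) 0 k
    = 2 * (cross (delta_mx 0 i) (delta_mx 0 j) *m G) 0 k.
  have /rowP/(_ k) := tors i j.
  by rewrite -scalemxAl [LHS]mxE [RHS]mxE [X in _ + X]mxE.
move: {tors} (E 0 1) (E 1 2) (E 2 0) => E01 E12 E20.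
have := (E01 0, E01 1, E01 2, (E12 0, E12 1, E12 2), (E20 0, E20 1, E20 2)).
rewrite !mxE !sum3E !crossE !mxE /= (sG 0 1) (sG 0 2) (sG 1 2).
move=> [[[[e0 e1] e2] [[e3 e4] e5]] [[e6 e7] e8]].
by apply/matrixP; apply: ord3_ind; apply: ord3_ind;
  rewrite /koszul /mxtrace !mxE sum3E /= ?mulr1n ?mulr0n
    ?(sG 0 1) ?(sG 0 2) ?(sG 1 2); lra.
Qed.

(** Row j of M i holds the coordinates of the covariant derivative of the j-th
    frame field in the i-th frame direction; [along M v] is the derivative
    operator in the direction v. *)
Definition along (M : 'I_3 -> 'M[R]_3) (v : 'rV[R]_3) : 'M[R]_3 :=
  \sum_i v 0 i *: M i.

(** Being skew, each M i *m G is the cross product with an axial vector, and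
    the vanishing of the torsion leaves only one choice for these vectors. *)
Lemma levi_civita_koszul G (M : 'I_3 -> 'M[R]_3) v w : G^T = G ->
  (forall i, (M i *m G)^T = - (M i *m G)) ->
  (forall i j, row j (M i) - row i (M j) =
    2 *: cross (delta_mx 0 i) (delta_mx 0 j)) ->
  w *m along M v *m G = cross w (v *m koszul G).
Proof.
move=> symG skew tors.
have /choice[u MG] i : exists b, M i *m G = crossmx b by exact: skew_crossmx.
pose U := \matrix_i u i; have rowU i : row i U = u i by rewrite rowK.
have <- : U = koszul G.
  apply: torsion_koszul => // i j; rewrite !rowU.
  rewrite -[cross _ (u i)]mul_crossmx -[cross _ (u j)]mul_crossmx -!MG -!rowE.
  by rewrite !row_mul -mulmxBl tors.
rewrite -mulmxA mulmx_suml mulmx_sumr mulmx_sum_row !sum3E !rowU.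
by rewrite !crossDr !crossZr -!scalemxAl -!scalemxAr !MG !mul_crossmx.
Qed.

(** Let a and b be the axial vectors of [along M v] with respect to G and H. As
    cross a a = 0 and G is invertible, [along M v] kills a, hence cross a b = 0:
    the maps koszul G and koszul H are pointwise collinear. *)
Lemma common_levi_civita G H (M : 'I_3 -> 'M[R]_3) :
  G^T = G -> H^T = H -> G \in unitmx -> H \in unitmx ->
  (forall i, (M i *m G)^T = - (M i *m G)) ->
  (forall i, (M i *m H)^T = - (M i *m H)) ->
  (forall i j, row j (M i) - row i (M j) =
    2 *: cross (delta_mx 0 i) (delta_mx 0 j)) ->
  exists2 c, c != 0 & H = c *: G.
Proof.
move=> symG symH uG uH skG skH tors.
have axial_collinear v : cross (v *m koszul H) (v *m koszul G) = 0.
  have : v *m koszul G *m along M v *m G = 0.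
    by rewrite levi_civita_koszul // crossxx.
  move=> /(canRL (mulmxK uG)); rewrite mul0mx => K0.
  by rewrite crossC -(levi_civita_koszul _ _ symH skH tors) K0 mul0mx oppr0.
have [i [j]] := koszul_rank_gt1 uG; rewrite !rowE => ij0.
have [c /koszul_inj_scale HG] := collinear_proportional axial_collinear ij0.
exists c => //; apply: contraTneq uH => c0.
by rewrite HG c0 scale0r unitmxE det0 // unitr0.
Qed.
End CrossProduct.

(** * Linear maps restricted to the sphere *)

Section LinearMaps.
Variables (R : realType) (W : normedModType R).
Implicit Types (F : 'rV[R]_4 -> W) (p : S3 R) (v : 'rV[R]_4).

Definition lin_map (V : lmodType R) (F : V -> W) (Flin : linear F) :
  {linear V -> W} := HB.pack F (GRing.isLinear.Build _ _ _ _ F Flin).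

Lemma rV_linear_continuous n (F : 'rV[R]_n -> W) : linear F -> continuous F.
Proof.
move=> Flin.
have -> : F = fun x : 'rV[R]_n => \sum_i x 0 i *: F (delta_mx 0 i).
  apply/funext => x; rewrite {1}(row_sum_delta x) -[F]/(lin_map Flin : _ -> _).
  by rewrite linear_sum; apply: eq_bigr => i _; rewrite linearZ.
apply: continuous_big => [|i _ x]; first exact: add_continuous.
have xi : {for x, continuous (fun y : 'rV[R]_n => y 0 i)}.
  exact: coord_continuous.
exact: (cvgZr_tmp xi).
Qed.

Lemma Cn_cst n (V : normedModType R) (k : W) : Cn n [set: V] (cst k).
Proof.
elim: n k => [|n IH] k; first by move=> x _; apply: cst_continuous.
split=> [x _|v]; first exact: differentiable_cst.
rewrite (_ : 'D_v (cst k) = cst 0); first exact: IH.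
by apply/funext => x; rewrite derive_cst.
Qed.

Lemma Cn_linear m n (F : 'rV[R]_m -> W) : linear F -> Cn n setT F.
Proof.
move=> Flin; have Fc := rV_linear_continuous Flin.
case: n => [x _|n]; first exact: Fc.
have Fd x : differentiable F x :=
  linear_differentiable (f := lin_map Flin) x Fc.
split=> [x _|v]; first exact: Fd.
rewrite (_ : 'D_v F = cst (F v)); first exact: Cn_cst.
apply/funext => x; rewrite deriveE //.
by rewrite (diff_lin (f := lin_map Flin) x Fc).
Qed.

Lemma smooth_linear F : linear F -> smooth (fun p : S3 R => F p).
Proof.
move=> Flin p; exists setT, F; split=> //; first exact: openT.
by move=> n; apply: Cn_linear.
Qed.

(** Along a tangent line the squared norm has no first-order term; this is why
    the retraction does not affect tangential derivatives. *)
Lemma qdot_tangent_line p v (h : R) : tangent p v ->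
  qdot (h *: v + p) (h *: v + p) = 1 + qdot v v * h ^+ 2.
Proof.
rewrite /tangent => pv; have := eqP (qvalP p); move: pv.
rewrite !qdotE !mxE => pv pp.
by rewrite -pp -[RHS]addr0 -(mulr0 (2 * h)) -pv; ring.
Qed.

Lemma qdot_ge0 v : 0 <= qdot v v.
Proof. by apply: sumr_ge0 => i _; rewrite -expr2 sqr_ge0. Qed.

Lemma qdotZ (k : R) v : qdot (k *: v) (k *: v) = k ^+ 2 * qdot v v.
Proof. by rewrite !qdotE !mxE; ring. Qed.

Lemma retractE (x : 'rV[R]_4) : 0 < qdot x x ->
  retract x = (Num.sqrt (qdot x x))^-1 *: x :> 'rV_4.
Proof.
move=> x0; rewrite /retract; apply: insubdK.
by rewrite unfold_in qdotZ exprVn sqr_sqrtr ?ltW // mulVf // gt_eqF.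
Qed.

Lemma is_derive_inv_sqrt (q : R) :
  is_derive (0 : R) 1 (fun h : R => (Num.sqrt (1 + q * h ^+ 2))^-1) 0.
Proof.
pose f (h : R) := 1 + q * h ^+ 2.
have f0 : f 0 = 1 by rewrite /f expr0n mulr0 addr0.
have Df : is_derive (0 : R) 1 f 0.
  by apply: is_derive_eq; rewrite !scale0r addr0 scaler0 mulr0.
have Ds : is_derive (f 0) 1 Num.sqrt (2 * Num.sqrt (f 0))^-1.
  by apply: is_derive1_sqrt; rewrite f0.
have := is_derive1_comp Ds Df; rewrite mulr0 => Dsf.
have := is_deriveV (f := Num.sqrt \o f) _ Dsf; rewrite scaler0; apply.
by rewrite /= f0 sqrtr1 oner_neq0.
Qed.

(** On the tangent line t |-> p + t v, the retraction is the multiplication by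
    s(t) = 1 / sqrt (1 + |v|^2 t^2). The difference quotient of F is therefore
    (s(t) - s(0)) / t *: F p + s(t) *: F v, and s has derivative 0 at 0. *)
Lemma dS_linear F p v : linear F -> tangent p v ->
  dS (fun q : S3 R => F q) p v = F v.
Proof.
move=> Flin pv; have FE k x y : F (k *: x + y) = k *: F x + F y := Flin k x y.
have FZ k x : F (k *: x) = k *: F x.
  by rewrite -[F]/(lin_map Flin : _ -> _) linearZ.
pose s (h : R) := (Num.sqrt (1 + qdot v v * h ^+ 2))^-1.
have s0 : s 0 = 1 by rewrite /s expr0n mulr0 addr0 sqrtr1 invr1.
have [sd sE] := is_derive_inv_sqrt (qdot v v).
have norm_gt0 h : 0 < qdot (h *: v + p) (h *: v + p).
  rewrite qdot_tangent_line //; apply: ltr_pwDl => //.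
  by rewrite mulr_ge0 ?qdot_ge0 ?sqr_ge0.
have retractp : retract p = p :> 'rV_4.
  by rewrite retractE (eqP (qvalP p)) ?sqrtr1 ?invr1 ?scale1r.
have sc : s h @[h --> (0 : R)^'] --> (1 : R).
  rewrite -s0; apply/continuous_withinNx/differentiable_continuous.
  exact/derivable1_diffP.
apply: cvg_lim => //.
rewrite -[X in _ --> X]add0r -[X in X + _](scale0r (F p)) -[X in _ + X]scale1r.
apply: (@cvg_trans _
  (((h^-1 * (s h - s 0)) *: F p + s h *: F v) @[h --> (0 : R)^'])).
  apply: near_eq_cvg; near=> h.
  have h0 : h != 0 by near: h; exact: nbhs_dnbhs_neq.
  rewrite /= retractE // retractp qdot_tangent_line // -/(s h) s0 FZ FE.
  have -> : s h *: (h *: F v + F p) - F p = (s h - 1) *: F p + (s h * h) *: F v.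
    by rewrite scalerDr scalerA scalerBl scale1r addrC addrA addrC addrA.
  by rewrite scalerDr !scalerA [_ * (_ * h)]mulrCA mulVf // mulr1.
apply: cvgD; apply: cvgZr_tmp => //.
rewrite -[X in _ --> X]sE
  (_ : (fun h => _) = fun h => h^-1 *: ((s \o shift 0) (h *: 1) - s 0)).
  exact: sd.
by apply/funext => h; rewrite /= addr0 [_%:A]mulr1.
Unshelve. all: by end_near. Qed.
End LinearMaps.

(** * Left invariant vector fields *)

Section LeftInvariantFields.
Variable R : realType.
Implicit Types (x y v : 'rV[R]_4) (a b : 'rV[R]_3) (p : S3 R).

Definition im a : 'rV[R]_4 := mkq 0 (a 0 0) (a 0 1) (a 0 2).

Definition pure x : 'rV[R]_3 := vec3 (x 0 1) (x 0 2) (x 0 3).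

Lemma imK : cancel im pure.
Proof. by move=> a; apply: rV3P; rewrite !vec3E !mkqE. Qed.

Lemma im_linear : linear im.
Proof.
by move=> k a b; apply: quatP;
  rewrite [RHS]mxE [X in _ = X + _]mxE !mkqE ?mxE; ring.
Qed.

Lemma imB a b : im (a - b) = im a - im b.
Proof.
by apply: quatP; rewrite [RHS]mxE [X in _ = _ + X]mxE !mkqE ?mxE; ring.
Qed.

Lemma qmul_linearl y : linear (fun x => qmul x y).
Proof.
by move=> k a b; apply: quatP;
  rewrite /= [RHS]mxE [X in _ = X + _]mxE !mkqE !mxE; ring.
Qed.

Lemma qmul_linearr x : linear (qmul x).
Proof.
by move=> k a b; apply: quatP;
  rewrite /= [RHS]mxE [X in _ = X + _]mxE !mkqE !mxE; ring.
Qed.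

Lemma tangent1P x : tangent (S3_one R) x -> x = im (pure x).
Proof.
rewrite /tangent qdotE !mkqE => x0.
by apply: quatP; rewrite !mkqE ?vec3E //; lra.
Qed.

Lemma tangent_im a : tangent (S3_one R) (im a).
Proof. by rewrite /tangent qdotE !mkqE; ring. Qed.

Definition left_field a : S3 R -> 'rV[R]_4 := fun p => qmul p (im a).

Lemma left_field1 a : left_field a (S3_one R) = im a.
Proof. exact: qmul1q. Qed.

Lemma tangentB p x y : tangent p x -> tangent p y -> tangent p (x - y).
Proof.
rewrite /tangent (_ : qdot p (x - y) = qdot p x - qdot p y).
  by move=> -> ->; rewrite subrr.
by rewrite !qdotE !mxE; ring.
Qed.

Lemma tangent_left_field a p : tangent p (left_field a p).
Proof. by rewrite /tangent /left_field qdotE !mkqE; ring. Qed.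

Lemma vector_field_left_field a : vector_field (left_field a).
Proof.
split=> [|p]; last exact: tangent_left_field.
exact: (smooth_linear (qmul_linearl (im a))).
Qed.

(** Left invariant fields span every tangent space: left translation by the
    conjugate of p brings v back to the imaginary quaternions. *)
Lemma tangent_left_fieldP p v : tangent p v ->
  exists a, v = left_field a p.
Proof.
move=> pv; exists (pure (qmul (qconj p) v)); rewrite /left_field -tangent1P.
  by rewrite qmulA qmulqV ?qmul1q //; apply/eqP/qvalP.
by move: pv; rewrite /tangent !qdotE !mkqE => pv; rewrite -[RHS]pv; ring.
Qed.

Lemma lieD_left_field (F : 'rV[R]_4 -> R^o) a : linear F ->
  lieD (left_field a) (fun p : S3 R => F p) = fun p : S3 R => F (qmul p (im a)).
Proof.
move=> Flin; apply/funext => p.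
by apply: dS_linear => //; exact: tangent_left_field.
Qed.

(** It suffices to test the bracket on the four coordinate functions: being
    linear, they are differentiated by [lieD_left_field], and the bracket
    becomes the commutator of imaginary quaternions. *)
Lemma bracket_left_field a b (Z : S3 R -> 'rV[R]_4) :
  (forall p, tangent p (Z p)) ->
  is_bracket (left_field a) (left_field b) Z ->
  Z = left_field (2 *: cross a b).
Proof.
move=> tZ ZE; apply/funext => p.
have coordE i : Z p 0 i =
    qmul (qmul p (im a)) (im b) 0 i - qmul (qmul p (im b)) (im a) 0 i.
  have Flin : linear (fun x : 'rV[R]_4 => x 0 i : R^o).
    by move=> k u v; rewrite !mxE.
  have Glin y : linear (fun x => qmul x y 0 i : R^o).
    by move=> k u v; rewrite qmul_linearl; exact: Flin.
  have Fd c : lieD (left_field c) (fun q : S3 R => (q : 'rV[R]_4) 0 i : R^o) =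
      fun q : S3 R => qmul q (im c) 0 i := lieD_left_field c Flin.
  have Gd y c : lieD (left_field c) (fun q : S3 R => qmul q y 0 i : R^o) =
      fun q : S3 R => qmul (qmul q (im c)) y 0 i := lieD_left_field c (Glin y).
  have := ZE _ (smooth_linear Flin) p; rewrite /= !Fd !Gd => <-.
  by rewrite /lieD (dS_linear Flin).
have crossE2 i : (2 *: cross a b) 0 i = 2 * cross a b 0 i by rewrite mxE.
by apply: quatP; rewrite coordE /left_field !mkqE !crossE2 !crossE; ring.
Qed.

End LeftInvariantFields.

(** * Left invariant metrics *)

Section LeftInvariantMetrics.
Variable R : realType.
Variable g : tensor02 R.
Hypotheses (g_metric : pseudo_riemannian g) (g_left : left_invariant g).
Implicit Types (a b : 'rV[R]_3) (p : S3 R).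

Definition gram : 'M[R]_3 :=
  \matrix_(i, j) g (S3_one R) (im (delta_mx 0 i)) (im (delta_mx 0 j)).

(** Left translation by p carries the values of left invariant fields at the
    unit to their values at p. *)
Lemma left_field_metric p a b :
  g p (left_field a p) (left_field b p) = g (S3_one R) (im a) (im b).
Proof.
have := g_left p (tangent_im a) (tangent_im b).
rewrite !(dS_linear (qmul_linearr p)); try exact: tangent_im.
by rewrite /left_translation mulg1.
Qed.

Lemma gram_sym : gram^T = gram.
Proof.
have [_ gC _ _] := g_metric.
by apply/matrixP => i j; rewrite !mxE gC //; exact: tangent_im.
Qed.

Lemma gramE a b : g (S3_one R) (im a) (im b) = (a *m gram *m b^T) 0 0.
Proof.
have [gL gC _ _] := g_metric.
have gl c : linear (fun a => g (S3_one R) (im a) (im c)).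
  by move=> k u v; rewrite im_linear gL //; exact: tangent_im.
have gE u c : g (S3_one R) (im u) (im c) =
    \sum_i u 0 i * g (S3_one R) (im (delta_mx 0 i)) (im c).
  rewrite {1}(row_sum_delta u) -[LHS]/((lin_map (gl c) : _ -> _) _).
  by rewrite linear_sum; apply: eq_bigr => i _; rewrite linearZ.
rewrite gC; try exact: tangent_im.
rewrite gE mxE; apply: eq_bigr => j _; rewrite gC; try exact: tangent_im.
rewrite gE !mxE mulrC; congr (_ * _); apply: eq_bigr => i _.
by rewrite mxE.
Qed.

Lemma gram_unit : gram \in unitmx.
Proof.
have [_ _ g0 _] := g_metric.
rewrite -row_free_unit -kermx_eq0; apply/rowV0P => v /sub_kermxP vG.
apply: (can_inj (@imK R)); rewrite (g0 (S3_one R) (im v)).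
- by apply: quatP; rewrite !mkqE !mxE.
- exact: tangent_im.
- by move=> w /tangent1P ->; rewrite gramE vG mul0mx mxE.
Qed.

(** The scalar products of left invariant fields are constant functions, so
    the left-hand side of the compatibility equation vanishes. *)
Lemma gram_skew nabla (M : 'I_3 -> 'M[R]_3) : metric_compatible g nabla ->
  (forall i j, nabla (left_field (delta_mx 0 i)) (left_field (delta_mx 0 j))
     (S3_one R) = im (row j (M i))) ->
  forall i, (M i *m gram)^T = - (M i *m gram).
Proof.
move=> compat ME i; apply/matrixP => j k.
have vf := @vector_field_left_field R.
have := compat _ _ _ (vf (delta_mx 0 k)) (vf (delta_mx 0 j))
  (vf (delta_mx 0 i)) (S3_one R).
rewrite (_ : (fun q => _) =
    cst (g (S3_one R) (im (delta_mx 0 k)) (im (delta_mx 0 j)))); last first.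
  by apply/funext => q; exact: left_field_metric.
rewrite /lieD /dS derive_cst !ME !left_field1.
have [_ gC _ _] := g_metric.
rewrite [g _ (im (delta_mx _ _)) _]gC; try exact: tangent_im.
have entry l m : g (S3_one R) (im (row l (M i))) (im (delta_mx 0 m)) =
    (M i *m gram) l m.
  by rewrite gramE trmx_delta -colE -row_mul !mxE.
rewrite !entry => /esym/eqP; rewrite addr_eq0 => /eqP kj.
by rewrite mxE [RHS]mxE.
Qed.

End LeftInvariantMetrics.

Theorem theorem3p1 (R : realType) (g : tensor02 R) :
  pseudo_riemannian g -> left_invariant g -> invariantly_rigid g.
Proof.
move=> mg lg h mh lh [nabla [[cn tn ng] [_ _ nh]]].
have vE (a : 'rV[R]_3) := vector_field_left_field a.
have [vn _ _ _ _] := cn.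
pose E (i : 'I_3) : 'rV[R]_3 := delta_mx 0 i.
pose D i j := nabla (left_field (E i)) (left_field (E j)).
have vD i j : vector_field (D i j) by apply: vn.
pose M (i : 'I_3) := \matrix_j pure (D i j (S3_one R)).
have ME i j : D i j (S3_one R) = im (row j (M i)).
  by rewrite rowK -tangent1P //; exact: (vD i j).2.
have tors i j : row j (M i) - row i (M j) = 2 *: cross (E i) (E j).
  apply: (can_inj (@imK R)).
  have tD p : tangent p ((D i j \- D j i) p).
    by apply: tangentB; apply: (vD _ _).2.
  have := bracket_left_field tD (tn _ _ (vE (E i)) (vE (E j))).
  by move=> /(congr1 (fun Z => Z (S3_one R))); rewrite left_field1 imB -!ME.
have [c c0 hg] := common_levi_civita (gram_sym mg) (gram_sym mh)
  (gram_unit mg) (gram_unit mh) (gram_skew mg lg ng ME)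
  (gram_skew mh lh nh ME) tors.
exists c => // p _ _ /tangent_left_fieldP[a ->] /tangent_left_fieldP[b ->].
by rewrite !left_field_metric // !gramE // hg -scalemxAr -scalemxAl mxE.
Qed.
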